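(* Let $K$ be a transition matrix on $\mathcal X=\{0,1,\dots,N\}$ generated by one of the convolutions listed in the context from measures of one family (Krawtchouk, Hahn or $q$-Hahn), and suppose that for some admissible parameter $\lambda$ of the same family $K(x,y)\,\pi(y,N,\lambda)=K(y,x)\,\pi(x,N,\lambda)$ for all $x,y\in\mathcal X$. Let $\kappa(n)$, $n\in\mathcal X$, be the eigenvalues of $K$ defined by $$\sum_{y\in\mathcal X}K(x,y)\,\pi(y,N,\lambda)\,\check P_n(y,\lambda)=\kappa(n)\,\pi(x,N,\lambda)\,\check P_n(x,\lambda)\qquad(x\in\mathcal X).$$ Then $$\kappa(n)=\sum_{y\in\mathcal X}K(0,y)\,\frac{\pi(y,N,\lambda)}{\pi(0,N,\lambda)}\,\check P_n(y,\lambda)\quad(n\in\mathcal X),\qquad \kappa(0)=1.$$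
   Context: Notation: $N\ge1$ integer, $(a)_n=a(a+1)\cdots(a+n-1)$, $(a;q)_n=\prod_{i=0}^{n-1}(1-aq^i)$, $0<q<1$ fixed. Measures $\pi(x,M,\lambda)$ for integers $0\le x\le M$ (zero for other integer arguments), and polynomials $\check P_n(x,\lambda)$, $n,x\in\mathcal X$ (normalised by $\check P_0(x)=1$, $\check P_n(0)=1$): - Krawtchouk, $\lambda=p$, $0<p<1$: $\pi(x,M,p)=\binom{M}{x}p^x(1-p)^{M-x}$; $\check P_n(x,p)=\sum_{k=0}^n\frac{(-n)_k(-x)_k}{(-N)_k\,k!}p^{-k}$. - Hahn, $\lambda=(a,b)$, $a,b>0$: $\pi(x,M,a,b)=\binom{M}{x}\frac{(a)_x(b)_{M-x}}{(a+b)_M}$; $\check P_n(x,a,b)=\sum_{k=0}^n\frac{(-n)_k(n+a+b-1)_k(-x)_k}{(a)_k(-N)_k\,k!}$. - $q$-Hahn, $\lambda=(a,b)$, $0<a<1$, $b<1$: $\pi(x,M,a,b)=\frac{(q;q)_M}{(q;q)_x(q;q)_{M-x}}\frac{(a;q)_x(b;q)_{M-x}a^{M-x}}{(ab;q)_M}$; $\check P_n(x,a,b)=\sum_{k=0}^n\frac{(q^{-n};q)_k(abq^{n-1};q)_k(q^{-x};q)_k}{(a;q)_k(q^{-N};q)_k(q;q)_k}q^k$. Convolutions ($x,y\in\mathcal X$; $\lambda_1,\lambda_2,\lambda_3$ admissible parameters of the family; (i)–(v) allowed for Krawtchouk and Hahn, (i), (iii), (iv) for $q$-Hahn): (i) $K(x,y)=\sum_{z=0}^{\min(x,y)}\pi(x-z,N-z,\lambda_2)\,\pi(z,y,\lambda_1)$;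 (ii) $K(x,y)=\sum_{z=\max(0,x+y-N)}^{\min(x,y)}\pi(x-z,N-y,\lambda_2)\,\pi(z,y,\lambda_1)$; (iii) $K(x,y)=\sum_{z=\max(x,y)}^{N}\pi(x,z,\lambda_2)\,\pi(z-y,N-y,\lambda_1)$; (iv) $K(x,y)=\sum_{z_2=0}^{\min(x,y)}\pi(z_2,y,\lambda_1)\sum_{z_1=\max(x,y)}^{N}\pi(x-z_2,z_1-z_2,\lambda_3)\,\pi(z_1-y,N-y,\lambda_2)$; (v) $K(x,y)=\sum_{z_2=0}^{\min(x,y)}\pi(z_2,y,\lambda_1)\sum_{z_1=x+y-z_2}^{N}\pi(x-z_2,z_1-y,\lambda_3)\,\pi(z_1-y,N-y,\lambda_2)$. In this setting each vector $\pi(x,N,\lambda)\check P_n(x,\lambda)$ is a right eigenvector of $K$, so $\kappa(n)$ is well defined. *)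

(* Defs.v *)
From HB Require Import structures.
From mathcomp Require Import all_boot all_order all_algebra.

Set Implicit Arguments.
Unset Strict Implicit.
Unset Printing Implicit Defensive.

Import Order.TTheory GRing.Theory Num.Theory.
Local Open Scope ring_scope.

Definition poch (R : realFieldType) (a : R) (n : nat) : R :=
  \prod_(i < n) (a + i%:R).

Definition qpoch (R : realFieldType) (q a : R) (n : nat) : R :=
  \prod_(i < n) (1 - a * q ^+ i).

Inductive measure_family := Krawtchouk | Hahn | QHahn.

Definition param (R : realFieldType) (F : measure_family) : Type :=
  match F with
  | Krawtchouk => R
  | Hahn | QHahn => (R * R)%type
  end.

Definition admissible (R : realFieldType) (F : measure_family) :
    param R F -> Prop :=
  match F with
  | Krawtchouk => fun p => 0 < p < 1
  | Hahn => fun ab => 0 < ab.1 /\ 0 < ab.2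
  | QHahn => fun ab => 0 < ab.1 < 1 /\ ab.2 < 1
  end.

Definition krawtchouk_pi (R : realFieldType) (x M : nat) (p : R) : R :=
  'C(M, x)%:R * p ^+ x * (1 - p) ^+ (M - x).

Definition hahn_pi (R : realFieldType) (x M : nat) (a b : R) : R :=
  'C(M, x)%:R * (poch a x * poch b (M - x)) / poch (a + b) M.

Definition qhahn_pi (R : realFieldType) (q : R) (x M : nat) (a b : R) : R :=
  qpoch q q M / (qpoch q q x * qpoch q q (M - x)) *
  (qpoch q a x * qpoch q b (M - x) * a ^+ (M - x)) / qpoch q (a * b) M.

(* The base q is only used by the q-Hahn family. *)
Definition opi (R : realFieldType) (q : R) (F : measure_family) (x M : nat) :
    param R F -> R :=
  match F with
  | Krawtchouk => fun p => if (x <= M)%N then krawtchouk_pi x M p else 0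
  | Hahn => fun ab => if (x <= M)%N then hahn_pi x M ab.1 ab.2 else 0
  | QHahn => fun ab => if (x <= M)%N then qhahn_pi q x M ab.1 ab.2 else 0
  end.

Definition krawtchouk_poly (R : realFieldType) (N n x : nat) (p : R) : R :=
  \sum_(0 <= k < n.+1)
    poch (- n%:R) k * poch (- x%:R) k / (poch (- N%:R) k * (k`!)%:R) * p ^- k.

Definition hahn_poly (R : realFieldType) (N n x : nat) (a b : R) : R :=
  \sum_(0 <= k < n.+1)
    poch (- n%:R) k * poch (n%:R + a + b - 1) k * poch (- x%:R) k /
    (poch a k * poch (- N%:R) k * (k`!)%:R).

(* The exponent n - 1 is an integer: it equals -1 for n = 0. *)
Definition qhahn_poly (R : realFieldType) (q : R) (N n x : nat) (a b : R) : R :=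
  \sum_(0 <= k < n.+1)
    qpoch q (q ^- n) k * qpoch q (a * b * q ^ (n%:Z - 1)) k *
    qpoch q (q ^- x) k /
    (qpoch q a k * qpoch q (q ^- N) k * qpoch q q k) * q ^+ k.

Definition Pcheck (R : realFieldType) (q : R) (F : measure_family)
    (N n x : nat) : param R F -> R :=
  match F with
  | Krawtchouk => fun p => krawtchouk_poly N n x p
  | Hahn => fun ab => hahn_poly N n x ab.1 ab.2
  | QHahn => fun ab => qhahn_poly q N n x ab.1 ab.2
  end.

Inductive convolution := Conv1 | Conv2 | Conv3 | Conv4 | Conv5.

Definition allowed (F : measure_family) (c : convolution) : bool :=
  match F, c with
  | QHahn, Conv2 | QHahn, Conv5 => false
  | _, _ => true
  end.

(* For x, y <= N no subtraction below is truncated on the summation ranges,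
   except the lower bound x + y - N of Conv2, where truncation gives
   max(0, x + y - N). A sum whose lower bound exceeds N is empty. *)
Definition conv_kernel (R : realFieldType) (q : R) (F : measure_family)
    (N : nat) (c : convolution) (l1 l2 l3 : param R F) (x y : nat) : R :=
  match c with
  | Conv1 =>
      \sum_(0 <= z < (minn x y).+1)
        opi q (x - z) (N - z) l2 * opi q z y l1
  | Conv2 =>
      \sum_(x + y - N <= z < (minn x y).+1)
        opi q (x - z) (N - y) l2 * opi q z y l1
  | Conv3 =>
      \sum_(maxn x y <= z < N.+1)
        opi q x z l2 * opi q (z - y) (N - y) l1
  | Conv4 =>
      \sum_(0 <= z2 < (minn x y).+1) opi q z2 y l1 *
        \sum_(maxn x y <= z1 < N.+1)
          opi q (x - z2) (z1 - z2) l3 * opi q (z1 - y) (N - y) l2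
  | Conv5 =>
      \sum_(0 <= z2 < (minn x y).+1) opi q z2 y l1 *
        \sum_(x + y - z2 <= z1 < N.+1)
          opi q (x - z2) (z1 - y) l3 * opi q (z1 - y) (N - y) l2
  end.

Definition conv_mx (R : realFieldType) (q : R) (F : measure_family) (N : nat)
    (c : convolution) (l1 l2 l3 : param R F) : 'M[R]_N.+1 :=
  \matrix_(x < N.+1, y < N.+1) conv_kernel q N c l1 l2 l3 x y.

(* Main.v *)
Require Import Defs.
From HB Require Import structures.
From mathcomp Require Import all_boot all_order all_algebra.
From mathcomp Require Import ring lra.

Set Implicit Arguments.
Unset Strict Implicit.
Unset Printing Implicit Defensive.

Import Order.TTheory GRing.Theory Num.Theory.
Local Open Scope ring_scope.

(* At x = 0 the eigenvector equation reads off kappa(n), because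
   pi(0,N,l) > 0 and the polynomials equal 1 at 0.  For n = 0 reversibility
   turns that equation into: kappa(0) is the sum of column 0 of K.  Column 0
   of every convolution is either a single measure pi(.,N) or a mixture of the
   measures pi(.,z) with weights pi(z,N), so it sums to 1 by the Vandermonde
   identity of the family. *)

(* With w i = i and q = 1 this is the Chu-Vandermonde identity, and with
   w i = 1 - q ^ i it is the q-Vandermonde identity. *)
Lemma vandermonde_prod (R : fieldType) (q : R) (w f g h : nat -> R)
    (wD : forall x y, w (x + y)%N = w x + q ^+ x * w y)
    (w_neq0 : forall i, w i.+1 != 0)
    (fgh : forall x y, f x + q ^+ x * g y = h (x + y)%N) (M : nat) :
  \sum_(x < M.+1) (\prod_(i < M) w i.+1) /
      ((\prod_(i < x) w i.+1) * \prod_(i < M - x) w i.+1) *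
      ((\prod_(i < x) f i) * \prod_(i < M - x) g i) = \prod_(i < M) h i.
Proof.
pose W n := \prod_(i < n) w i.+1.
(* Dividing by [W] makes the claim a Cauchy product: the convolution of [A] and [B] at [M], times
   [W M]. Each factor obeys a first-order recurrence, as coefficients of a basic hypergeometric
   series do. *)
pose A n := (\prod_(i < n) f i) / W n.
pose B n := (\prod_(i < n) g i) / W n.
have w0 : w 0%N = 0.
  have := wD 0%N 0%N; rewrite addn0 expr0 mul1r -{1}[w 0%N]addr0.
  by move/addrI.
have W_neq0 n : W n != 0 by apply/prodf_neq0.
have recA n : w n.+1 * A n.+1 = f n * A n.
  have := W_neq0 n; have := w_neq0 n.
  by rewrite /A /W !big_ord_recr /= => *; field; apply/andP.
have recB n : w n.+1 * B n.+1 = g n * B n.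
  have := W_neq0 n; have := w_neq0 n.
  by rewrite /B /W !big_ord_recr /= => *; field; apply/andP.
transitivity (W M * \sum_(x < M.+1) A x * B (M - x)%N).
  rewrite mulr_sumr; apply: eq_bigr => x _; rewrite -/(W _) -/(W _) -/(W _).
  by rewrite /A /B invfM; ring.
elim: M => [|M IH]; first by rewrite big_ord1 /A /B /W !big_ord0 !divr1 !mulr1.
rewrite [RHS]big_ord_recr /= -IH {1}/W big_ord_recr /= -/(W _) -2!mulrA.
congr (_ * _); rewrite [RHS]mulrC [in RHS]mulr_sumr [in LHS]mulr_sumr.
(* The factor [w M.+1] is distributed as w(x) + q^x w(M+1-x). The first part lowers the index of [A]
   by [recA], the second that of [B] by [recB]. *)
transitivity (\sum_(x < M.+2) (w x * A x * B (M.+1 - x)%N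
                + q ^+ x * A x * (w (M.+1 - x)%N * B (M.+1 - x)%N))).
  apply: eq_bigr => x _; rewrite -{1}(subnKC (leq_ord x)) wD; ring.
(* Since w(0) = 0, the first sum loses its term x = 0 and the second its term x = M+1. Shifting the
   first aligns the two, and [fgh] merges the coefficients f(x) + q^x g(M-x) into h(M). *)
rewrite big_split /= big_ord_recl w0 !mul0r add0r.
rewrite [X in _ + X]big_ord_recr /= subnn w0 mul0r mulr0 addr0 -big_split /=.
apply: eq_bigr => x _; have xM : (x <= M)%N by rewrite -ltnS.
rewrite /bump /= add1n subSS recA subSn // recB.
have := fgh x (M - x)%N; rewrite subnKC // => <-; ring.
Qed.

Lemma poch_gt0 (R : realFieldType) (a : R) n : 0 < a -> 0 < poch a n.
Proof. by move=> a0; apply: prodr_gt0 => i _; rewrite ltr_wpDr. Qed.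

Lemma poch0S (R : realFieldType) n : poch (0 : R) n.+1 = 0.
Proof. by rewrite /poch big_ord_recl /= addr0 mul0r. Qed.

Lemma poch1 (R : realFieldType) n : poch (1 : R) n = n`!%:R.
Proof.
rewrite fact_prod natr_prod big_add1 big_mkord.
by apply: eq_bigr => i _; rewrite nat1r.
Qed.

(** Negative [a] is included, as the parameter b of q-Hahn may be negative: 0 < q^i <= 1 keeps a q^i
    below 1 for either sign. *)
Lemma qpoch_gt0 (R : realFieldType) (q a : R) n :
  0 < q < 1 -> a < 1 -> 0 < qpoch q a n.
Proof.
move=> /andP[q0 q1] a1; apply: prodr_gt0 => i _; rewrite subr_gt0.
have qi0 : 0 < q ^+ i by rewrite exprn_gt0.
have qi1 : q ^+ i <= 1 by rewrite exprn_ile1 ?ltW.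
by nra.
Qed.

Lemma qpoch1S (R : realFieldType) (q : R) n : qpoch q 1 n.+1 = 0.
Proof. by rewrite /qpoch big_ord_recl /= mulr1 subrr mul0r. Qed.

Lemma krawtchouk_pi_sum (R : realFieldType) M (p : R) :
  \sum_(x < M.+1) krawtchouk_pi x M p = 1.
Proof.
transitivity ((1 - p + p) ^+ M); last by rewrite subrK expr1n.
rewrite exprDn; apply: eq_bigr => x _.
by rewrite /krawtchouk_pi -mulr_natr; ring.
Qed.

Lemma hahn_pi_sum (R : realFieldType) M (a b : R) :
  0 < a -> 0 < b -> \sum_(x < M.+1) hahn_pi x M a b = 1.
Proof.
move=> a0 b0; rewrite -mulr_suml.
apply: (canLR (mulfK _)); first by rewrite gt_eqF // poch_gt0 // addr_gt0.
rewrite mul1r.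
have wE n : \prod_(i < n) (i.+1%:R : R) = n`!%:R.
  by rewrite -poch1; apply: eq_bigr => i _; rewrite nat1r.
rewrite /poch -[RHS](@vandermonde_prod _ 1 (fun i => i%:R) (fun i => a + i%:R)
  (fun i => b + i%:R) (fun i => a + b + i%:R)).
- apply: eq_bigr => x _; rewrite -!/(poch _ _) !wE; congr (_ * _).
  rewrite -natrM -(bin_fact (leq_ord x)) natrM mulfK //.
  by rewrite pnatr_eq0 -lt0n muln_gt0 !fact_gt0.
- by move=> x y; rewrite expr1n mul1r natrD.
- by move=> i; rewrite pnatr_eq0.
- by move=> x y; rewrite natrD expr1n; ring.
Qed.

Lemma qhahn_pi_sum (R : realFieldType) (q : R) M (a b : R) :
  0 < q < 1 -> 0 < a < 1 -> b < 1 -> \sum_(x < M.+1) qhahn_pi q x M a b = 1.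
Proof.
move=> hq /andP[a0 a1] b1; rewrite -mulr_suml.
have ab1 : a * b < 1 by nra.
apply: (canLR (mulfK _)); first by rewrite gt_eqF // qpoch_gt0.
rewrite mul1r.
have wE n : \prod_(i < n) (1 - q ^+ i.+1) = qpoch q q n.
  by apply: eq_bigr => i _; rewrite exprS.
(* The extra factor a in g produces the weight a^(M-x) and makes a q^x cancel in (1 - a q^x) + q^x
   (1 - b q^y) a = 1 - ab q^(x+y). *)
have gE n : \prod_(i < n) ((1 - b * q ^+ i) * a) = qpoch q b n * a ^+ n.
  by rewrite big_split /= prodr_const card_ord.
rewrite /qpoch -[RHS](@vandermonde_prod _ q (fun i => 1 - q ^+ i)
  (fun i => 1 - a * q ^+ i) (fun i => (1 - b * q ^+ i) * a)
  (fun i => 1 - a * b * q ^+ i)).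
- by apply: eq_bigr => x _; rewrite -!/(qpoch _ _ _) !wE gE !mulrA.
- by move=> x y; rewrite exprD; ring.
- move=> i; have /andP[q0 q1] := hq.
  by rewrite gt_eqF // subr_gt0 exprn_ilt1 // ltW.
- by move=> x y; rewrite exprD; ring.
Qed.

Section OrthogonalityMeasure.
Variables (R : realFieldType) (q : R) (hq : 0 < q < 1) (F : measure_family).
Implicit Type l : param R F.

Lemma opi_gtn x M l : (M < x)%N -> opi q x M l = 0.
Proof. by rewrite ltnNge; case: F l => l /negPf /= ->. Qed.

(** The range may exceed the support, so that measures with different M can be summed over one
    common range. *)
Lemma opi_sum M n l : admissible l -> (M <= n)%N ->
  \sum_(x < n.+1) opi q x M l = 1.
Proof.
move=> hl Mn.
have -> : \sum_(x < n.+1) opi q x M l = \sum_(x < M.+1) opi q x M l.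
  rewrite [RHS](big_ord_widen n.+1 (fun x => opi q x M l)) // [RHS]big_mkcond.
  apply: eq_bigr => x _; case: ltnP => // Mx; exact: opi_gtn.
case: F l hl => /= l hl; under eq_bigr => x _ do rewrite leq_ord.
- exact: krawtchouk_pi_sum.
- by case: hl => a0 b0; exact: hahn_pi_sum.
- by case: hl => a01 b1; exact: qhahn_pi_sum.
Qed.

Lemma opi00 l : admissible l -> opi q 0 0 l = 1.
Proof. by move=> hl; rewrite -(@opi_sum 0 0 l hl) // big_ord1. Qed.

Lemma opi0_gt0 M l : admissible l -> 0 < opi q 0 M l.
Proof.
case: F l => /= [p /andP[p0 p1]|[a b] [/= a0 b0]|[a b] [/= /andP[a0 a1] b1]].
- by rewrite /krawtchouk_pi bin0 !mul1r subn0 exprn_gt0 // subr_gt0.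
- rewrite /hahn_pi bin0 mul1r divr_gt0 ?mulr_gt0 ?poch_gt0 ?addr_gt0 //.
- have [_ q1] := andP hq; have ab1 : a * b < 1 by nra.
  rewrite /qhahn_pi.
  by do !apply: divr_gt0 || apply: mulr_gt0 || apply: exprn_gt0 ||
    apply: qpoch_gt0.
Qed.

(** For k >= 1 the factor (-x)_k, or (q^-x;q)_k, vanishes at x = 0, so only the term k = 0
    survives. *)
Lemma Pcheck_x0 N n l : Pcheck q N n 0 l = 1.
Proof.
case: F l => /= l.
- rewrite /krawtchouk_poly big_nat_recl // big1 => [|i _].
    by rewrite /poch !big_ord0 expr0 fact0 !(mulr1, divr1, addr0).
  by rewrite oppr0 poch0S mulr0 !mul0r.
- rewrite /hahn_poly big_nat_recl // big1 => [|i _].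
    by rewrite /poch !big_ord0 fact0 !(mulr1, divr1, addr0).
  by rewrite oppr0 poch0S mulr0 !mul0r.
- rewrite /qhahn_poly big_nat_recl // big1 => [|i _].
    by rewrite /qpoch !big_ord0 expr0 !(mulr1, divr1, addr0).
  by rewrite expr0 invr1 qpoch1S mulr0 !mul0r.
Qed.

Lemma Pcheck_n0 N x l : Pcheck q N 0 x l = 1.
Proof.
case: F l => /= l.
- rewrite /krawtchouk_poly big_nat1 /poch !big_ord0 expr0 fact0.
  by rewrite !(mulr1, divr1).
- by rewrite /hahn_poly big_nat1 /poch !big_ord0 fact0 !(mulr1, divr1, addr0).
- by rewrite /qhahn_poly big_nat1 /qpoch !big_ord0 expr0 !(mulr1, divr1, addr0).
Qed.

Lemma opi_mixture_sum N l l' : admissible l -> admissible l' ->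
  \sum_(x < N.+1) \sum_(x <= z < N.+1) opi q x z l * opi q z N l' = 1.
Proof.
move=> hl hl'; rewrite -(opi_sum hl' (leqnn N)).
(* The terms added with z < x are zero. With z no longer bounded by x the sums can be exchanged, and
   each inner measure has mass 1. *)
transitivity (\sum_(x < N.+1) \sum_(z < N.+1) opi q x z l * opi q z N l').
  apply: eq_bigr => x _; rewrite big_geq_mkord big_mkcond.
  apply: eq_bigr => z _.
  by case: leqP => // zx; rewrite opi_gtn ?mul0r.
rewrite exchange_big; apply: eq_bigr => z _ /=.
by rewrite -mulr_suml (opi_sum hl) ?mul1r // -ltnS.
Qed.

Lemma conv_kernel_col0_sum N c (l1 l2 l3 : param R F) :
  admissible l1 -> admissible l2 -> admissible l3 ->
  \sum_(x < N.+1) conv_kernel q N c l1 l2 l3 x 0 = 1.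
Proof.
move=> hl1 hl2 hl3; case: c => /=.
(* For y = 0 any sum up to min(x,y) keeps only its index 0, with weight pi(0,0) = 1 by [opi00]. *)
- rewrite -(opi_sum hl2 (leqnn N)); apply: eq_bigr => x _.
  by rewrite minn0 big_nat1 opi00 // !subn0 mulr1.
- rewrite -(opi_sum hl2 (leqnn N)); apply: eq_bigr => x _.
  have -> : (x + 0 - N = 0)%N by apply/eqP; rewrite addn0 subn_eq0 leq_ord.
  by rewrite minn0 big_nat1 opi00 // !subn0 mulr1.
- rewrite -(opi_mixture_sum N hl2 hl1); apply: eq_bigr => x _.
  by rewrite maxn0 subn0; apply: eq_bigr => z _; rewrite subn0.
- rewrite -(opi_mixture_sum N hl3 hl2); apply: eq_bigr => x _.
  rewrite minn0 big_nat1 opi00 // mul1r maxn0 !subn0.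
  by apply: eq_bigr => z _; rewrite !subn0.
- rewrite -(opi_mixture_sum N hl3 hl2); apply: eq_bigr => x _.
  rewrite minn0 big_nat1 opi00 // mul1r addn0 !subn0.
  by apply: eq_bigr => z _; rewrite !subn0.
Qed.

End OrthogonalityMeasure.

Theorem theorem2p2 (R : realFieldType) (q : R) (hq : 0 < q < 1)
    (N : nat) (hN : (1 <= N)%N)
    (F : measure_family) (c : convolution) (hc : allowed F c)
    (l1 l2 l3 : param R F)
    (hl1 : admissible l1) (hl2 : admissible l2) (hl3 : admissible l3)
    (K : 'M[R]_N.+1) (hK : K = conv_mx q N c l1 l2 l3)
    (l : param R F) (hl : admissible l)
    (hrev : forall x y : 'I_N.+1, K x y * opi q y N l = K y x * opi q x N l)
    (kappa : 'I_N.+1 -> R)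
    (hkappa : forall n x : 'I_N.+1,
       \sum_(y < N.+1) K x y * opi q y N l * Pcheck q N n y l
       = kappa n * opi q x N l * Pcheck q N n x l) :
  (forall n : 'I_N.+1,
     kappa n = \sum_(y < N.+1)
       K ord0 y * (opi q y N l / opi q 0 N l) * Pcheck q N n y l)
  /\ kappa ord0 = 1.
Proof.
have pi0 : opi q 0 N l != 0 by rewrite gt_eqF ?opi0_gt0.
split=> [n|].
  apply: (mulIf pi0); have := hkappa n ord0.
  rewrite /= Pcheck_x0 mulr1 => <-; rewrite mulr_suml.
  by apply: eq_bigr => y _; field.
apply: (mulIf pi0); have := hkappa ord0 ord0; rewrite /= Pcheck_x0 mulr1 => <-.
rewrite -(conv_kernel_col0_sum hq N c hl1 hl2 hl3) mulr_suml.
apply: eq_bigr => y _.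
by rewrite Pcheck_n0 mulr1 hrev hK mxE.
Qed.
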